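(* Let $d\ge2$, $\gamma\ge0$, and let $\mathcal{D}_\gamma$ denote the entropy dissipation functional of the linear Boltzmann operator associated to the collision kernel $B(|q|,\xi)=c_d|q|^\gamma\xi^{d-2}$, with Maxwellian background $M$ of temperature $\theta>0$ and bulk velocity $u_0\in\mathbb{R}^d$. There exists a constant $C>0$, depending only on $\gamma$ (and on the dimension $d$), such that $$\mathcal{D}_\gamma(f)\ \ge\ C\,\theta^{\gamma/2}\,\mathcal{D}_0(f)$$ for any probability distribution $f$ on $\mathbb{R}^d$.
   Context: $M(v)=(2\pi\theta)^{-d/2}\exp\left(-\frac{|v-u_0|^2}{2\theta}\right)$. A probability distribution is a nonnegative $f\in L^1(\mathbb{R}^d)$ with $\int f\,dv=1$. For $v,v_*\in\mathbb{R}^d$, $n\in\mathbb{S}^{d-1}$ put $q=v-v_*$, $\xi=|q\cdot n|/|q|$, $v'=v-(q\cdot n)n$. The entropy dissipation functional of a collision kernel $B$ is $$\mathcal{D}(f)=\frac12\int_{\mathbb{R}^d}\int_{\mathbb{R}^d}\int_{\mathbb{S}^{d-1}}B(|q|,\xi)M(v)M(v_* )\,\Psi\left(\frac{f(v)}{M(v)},\frac{f(v')}{M(v')}\right)dn\,dv_*\,dv\in[0,+\infty],$$ with $\Psi(x,y)=(x-y)(\log x-\log y)$ (with $\Psi(0,0)=0$ and $\Psi(x,0)=\Psi(0,x)=+\infty$ for $x>0$). The constant $c_d>0$ is the normalization constant such that $\int_{\mathbb{S}^{d-1}}c_d|\tilde q\cdot n|^{d-2}\,dn=1$ for $\tilde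 q\in\mathbb{S}^{d-1}$. *)

(* Defs.v *)
From HB Require Import structures.
From mathcomp Require Import all_boot all_order all_algebra.
From mathcomp Require Import all_classical all_reals all_analysis.
From mathcomp Require Import measurable_realfun.

Set Implicit Arguments.
Unset Strict Implicit.
Unset Printing Implicit Defensive.

Import Order.TTheory GRing.Theory Num.Theory.
Import numFieldNormedType.Exports.

Local Open Scope classical_set_scope.
Local Open Scope ring_scope.

(* Row vectors carry the product sigma-algebra, as tuples do in
   MathComp-Analysis. *)
Definition measure_rV_display : measure_display -> measure_display.
Proof. exact. Qed.

Section measurable_rV.
Context {dT : measure_display} {T : sigmaRingType dT}.
Variable n : nat.

Let coors : 'I_n -> 'rV[T]_n -> T := fun i x => x ord0 i.

Let rV_set0 : g_sigma_preimage coors set0.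
Proof. exact: sigma_algebra0. Qed.

Let rV_setC A : g_sigma_preimage coors A -> g_sigma_preimage coors (~` A).
Proof. exact: sigma_algebraC. Qed.

Let rV_bigcup (F : _^nat) : (forall i, g_sigma_preimage coors (F i)) ->
  g_sigma_preimage coors (\bigcup_i (F i)).
Proof. exact: sigma_algebra_bigcup. Qed.

HB.instance Definition _ := @isMeasurable.Build (measure_rV_display dT)
  'rV[T]_n (g_sigma_preimage coors) rV_set0 rV_setC rV_bigcup.

End measurable_rV.

Lemma measurable_rV_coor d (T : sigmaRingType d) n (i : 'I_n) :
  measurable_fun [set: 'rV[T]_n] (fun x : 'rV[T]_n => x ord0 i).
Proof.
move=> _ Y mY; rewrite setTI; apply: sub_sigma_algebra => /=.
rewrite -bigcup_seq/=; exists i => /=; first by rewrite mem_index_enum.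
by exists Y => //; rewrite setTI.
Qed.

Lemma measurable_fun_rVP d1 d2 (T1 : measurableType d1) (T2 : measurableType d2)
    n (f : T1 -> 'rV[T2]_n) :
  measurable_fun [set: T1] f <->
  forall i, measurable_fun [set: T1] (fun x => f x ord0 i).
Proof.
split=> [mf i|mf].
  exact: (measurableT_comp (@measurable_rV_coor _ _ n i) mf).
move=> _ A mA; rewrite setTI.
suff : @measurable _ 'rV[T2]_n `<=` [set A | measurable (f @^-1` A)] by exact.
apply: smallest_sub.
  split=> /=.
  - by rewrite preimage_set0.
  - by move=> B mB; rewrite setTD preimage_setC; exact: measurableC.
  - by move=> F mF; rewrite preimage_bigcup; exact: bigcup_measurable.
rewrite -bigcup_seq; apply: bigcup_sub => i _ _ [B mB <-] /=.
by rewrite setTI; have := mf i measurableT B mB; rewrite setTI.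
Qed.

Section lebesgue_measure_rV.
Context {R : realType}.
Local Open Scope ereal_scope.

Definition rV_cons n (p : measurableTypeR R * 'rV[R]_n) : 'rV[R]_n.+1 :=
  \row_i (if unlift ord0 i is Some j then p.2 ord0 j else p.1).

Lemma measurable_rV_cons n : measurable_fun [set: _] (@rV_cons n).
Proof.
apply/measurable_fun_rVP => i; rewrite /rV_cons.
case: (unliftP ord0 i) => [j|] ->.
  rewrite (_ : (fun _ => _) = (fun v : 'rV[R]_n => v ord0 j) \o snd).
    by apply: measurableT_comp => //; exact: measurable_rV_coor.
  by apply/funext => p /=; rewrite mxE liftK.
rewrite (_ : (fun _ => _) = fst); first exact: measurable_fst.
by apply/funext => p /=; rewrite mxE unlift_none.
Qed.

HB.instance Definition _ n :=
  isMeasurableFun.Build _ _ _ _ (@rV_cons n) (@measurable_rV_cons n).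

Lemma measurable_rV_head n :
  measurable_fun [set: 'rV[R]_n.+1]
    (fun x : 'rV[R]_n.+1 => x ord0 ord0 : measurableTypeR R).
Proof. exact: measurable_rV_coor. Qed.

Lemma measurable_rV_behead n :
  measurable_fun [set: 'rV[R]_n.+1]
    (fun x : 'rV[R]_n.+1 => \row_(i < n) x ord0 (lift ord0 i)).
Proof.
apply/measurable_fun_rVP => i.
rewrite (_ : (fun _ => _) = (fun x : 'rV[R]_n.+1 => x ord0 (lift ord0 i))).
  exact: measurable_rV_coor.
by apply/funext => x; rewrite mxE.
Qed.

Section cons_measure.
Variables (n : nat) (mu : {sigma_finite_measure set 'rV[R]_n -> \bar R}).

Definition cons_measure : set 'rV[R]_n.+1 -> \bar R :=
  pushforward (@lebesgue_measure R \x mu) (@rV_cons n).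

Let cons_measure0 : cons_measure set0 = 0.
Proof. by rewrite /cons_measure /pushforward preimage_set0 measure0. Qed.

Let cons_measure_ge0 A : 0 <= cons_measure A.
Proof. exact: (measure_ge0 (@lebesgue_measure R \x mu)). Qed.

Let cons_measure_sigma_additive : semi_sigma_additive cons_measure.
Proof.
exact: (@measure_semi_sigma_additive _ _ _ 
  (pushforward (@lebesgue_measure R \x mu) (@rV_cons n))).
Qed.

HB.instance Definition _ := isMeasure.Build _ _ _ cons_measure
  cons_measure0 cons_measure_ge0 cons_measure_sigma_additive.

Let cons_measure_sigma_finite : sigma_finite setT cons_measure.
Proof.
have /sigma_finiteP[F [TF ndF Foo]] := sigma_finiteT (@lebesgue_measure R).
have /sigma_finiteP[G [TG ndG Goo]] := sigma_finiteT mu.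
pose h (x : 'rV[R]_n.+1) : measurableTypeR R * 'rV[R]_n :=
  (x ord0 ord0, \row_(i < n) x ord0 (lift ord0 i)).
have mh : measurable_fun setT h.
  by apply/measurable_fun_pairP; split;
    [exact: measurable_rV_head|exact: measurable_rV_behead].
have hK : cancel (@rV_cons n) h.
  move=> [x v]; rewrite /h /rV_cons /= mxE unlift_none; congr pair.
  by apply/rowP => i; rewrite !mxE liftK.
exists (fun k => h @^-1` (F k `*` G k)).
  apply/esym/seteqP; split=> // x _.
  have [i _ Fi] : (\bigcup_i F i) (h x).1 by rewrite -TF.
  have [j _ Gj] : (\bigcup_i G i) (h x).2 by rewrite -TG.
  exists (maxn i j) => //; split.
  - by move: Fi; exact/subsetPset/ndF/leq_maxl.
  - by move: Gj; exact/subsetPset/ndG/leq_maxr.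
move=> k; have [mF Fk] := Foo k; have [mG Gk] := Goo k; split.
  by rewrite -[X in measurable X]setTI; apply: mh => //; exact: measurableX.
rewrite /cons_measure /pushforward -comp_preimage.
rewrite (_ : _ \o _ = id) ?preimage_id; last exact/funext.
by rewrite product_measure1E// lte_mul_pinfty// ge0_fin_numE.
Qed.

HB.instance Definition _ := Measure_isSigmaFinite.Build _ _ _ cons_measure
  cons_measure_sigma_finite.

End cons_measure.

Fixpoint lebesgue_rV n : {sigma_finite_measure set 'rV[R]_n -> \bar R} :=
  match n with
  | 0%N => dirac (0%R : 'rV[R]_0)
  | n'.+1 => cons_measure (lebesgue_rV n')
  end.

Lemma lebesgue_rV_box n (A : 'I_n -> set R) : (forall i, measurable (A i)) ->
  lebesgue_rV n [set x | forall i, A i (x ord0 i)] =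
  \prod_(i < n) lebesgue_measure (A i).
Proof.
elim: n A => [|n IH] A mA.
  by rewrite big_ord0 /= diracE mem_set//= => -[].
rewrite big_ord_recl /= /cons_measure /pushforward.
rewrite -IH; last by move=> i; exact: mA.
have mB : measurable [set x : 'rV[R]_n | forall i, A (lift ord0 i) (x ord0 i)].
  rewrite (_ : [set _ | _] = \bigcap_(i in [set: 'I_n])
      ((fun x : 'rV[R]_n => x ord0 i) @^-1` A (lift ord0 i))).
    apply: fin_bigcap_measurable; first exact: finite_finset.
    move=> i _; rewrite -[X in measurable X]setTI.
    exact: (@measurable_rV_coor _ _ n i measurableT _ (mA _)).
  by apply/seteqP; split=> x /= Ax; [move=> i _|move=> i; exact: Ax].
rewrite -product_measure1E//; last exact: mA.
apply: (congr1 (@lebesgue_measure R \x lebesgue_rV n)).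
apply/seteqP; split=> -[x v] /=; rewrite /rV_cons.
  move=> Axv; split; first by have := Axv ord0; rewrite mxE unlift_none.
  by move=> i; have := Axv (lift ord0 i); rewrite mxE liftK.
by move=> [Ax Av] i; rewrite mxE; case: unliftP => [j|] ->.
Qed.

End lebesgue_measure_rV.

Section euclidean.
Context {R : realType} {d : nat}.
Implicit Types x y : 'rV[R]_d.

Definition dot x y : R := \sum_(i < d) x ord0 i * y ord0 i.

(* The library norm on 'rV[R]_d is the maximum norm. *)
Definition enorm x : R := Num.sqrt (dot x x).

Definition sphere : set 'rV[R]_d := [set x | enorm x = 1].

Definition punctured_ball : set 'rV[R]_d := [set x | 0 < enorm x <= 1].

Definition direction x : 'rV[R]_d := (enorm x)^-1 *: x.

Lemma enorm_ge0 x : 0 <= enorm x.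
Proof. exact: sqrtr_ge0. Qed.

Lemma measurable_enorm : measurable_fun [set: 'rV[R]_d] enorm.
Proof.
apply: (@measurableT_comp _ _ _ _ _ _ (@Num.sqrt R)).
  by apply: continuous_measurable_fun; exact: sqrt_continuous.
apply: measurable_sum => i.
by apply: measurable_funM; exact: measurable_rV_coor.
Qed.

Lemma measurable_punctured_ball : measurable punctured_ball.
Proof.
rewrite (_ : punctured_ball = enorm @^-1` `]0, 1]).
  by rewrite -[X in measurable X]setTI; exact: measurable_enorm.
by apply/seteqP; split=> x /=; rewrite in_itv.
Qed.

Lemma measurable_direction : measurable_fun [set: 'rV[R]_d] direction.
Proof.
apply/measurable_fun_rVP => i.
rewrite (_ : (fun _ => _) = fun x => (enorm x `^ (-1)) * x ord0 i); last first.
  by apply/funext => x; rewrite mxE powR_inv1// enorm_ge0.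
apply: measurable_funM; last exact: measurable_rV_coor.
apply: (@measurableT_comp _ _ _ _ _ _ (@powR R ^~ (-1)) _ enorm).
  exact: measurable_powR.
exact: measurable_enorm.
Qed.

HB.instance Definition _ :=
  isMeasurableFun.Build _ _ _ _ direction measurable_direction.

(* Polar coordinates: sigma(A) is d times the Lebesgue measure of the cone
   {r n | n \in A, 0 < r <= 1}. *)
Definition sphere_measure : set 'rV[R]_d -> \bar R :=
  pushforward
    (mscale (d%:R)%:nng (mrestr (lebesgue_rV d) measurable_punctured_ball))
    direction.

Let sphere_measure0 : sphere_measure set0 = 0%E.
Proof. exact: measure0. Qed.

Let sphere_measure_ge0 A : (0 <= sphere_measure A)%E.
Proof. exact: measure_ge0. Qed.

Let sphere_measure_sigma_additive : semi_sigma_additive sphere_measure.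
Proof. exact: measure_semi_sigma_additive. Qed.

HB.instance Definition _ := isMeasure.Build _ _ _ sphere_measure
  sphere_measure0 sphere_measure_ge0 sphere_measure_sigma_additive.

End euclidean.

Arguments dot {R d} x y.
Arguments sphere : clear implicits.
Arguments sphere_measure : clear implicits.

Section linear_boltzmann.
Context {R : realType} {d : nat}.
Implicit Types (v n u : 'rV[R]_d) (f : 'rV[R]_d -> R).

Definition maxwellian (theta : R) u v : R :=
  (2 * pi * theta) `^ (- (d%:R / 2)) *
  expR (- (enorm (v - u) ^+ 2 / (2 * theta))).

(* f is an everywhere nonnegative Borel representative of its L^1 class. *)
Definition probability_density f : Prop :=
  [/\ forall v, 0 <= f v,
      (lebesgue_rV d).-integrable setT (EFin \o f) &
      (\int[lebesgue_rV d]_v (f v)%:E = 1)%E].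

(* Only used for nonnegative arguments. *)
Definition Psi (x y : R) : \bar R :=
  if (x == 0) && (y == 0) then 0%E
  else if (x == 0) || (y == 0) then +oo%E
  else ((x - y) * (ln x - ln y))%:E.

Definition xi v vs n : R := `|dot (v - vs) n| / enorm (v - vs).

Definition post_collision v vs n : 'rV[R]_d := v - dot (v - vs) n *: n.

Definition entropy_dissipation (theta : R) u (B : R -> R -> R) f : \bar R :=
  let M := maxwellian theta u in
  ((2^-1)%:E *
   \int[lebesgue_rV d]_v \int[lebesgue_rV d]_vs
     \int[sphere_measure R d]_(n in sphere R d)
       ((B (enorm (v - vs)%R) (xi v vs n) * M v * M vs)%:E *
        Psi (f v / M v)
            (f (post_collision v vs n) / M (post_collision v vs n))))%E.

Definition collision_kernel (c gamma : R) : R -> R -> R :=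
  fun r x => c * r `^ gamma * x ^+ (d - 2).

Definition normalization_constant (c : R) : Prop :=
  0 < c /\ forall q, q \in sphere R d ->
    (\int[sphere_measure R d]_(n in sphere R d)
       (c * `|dot q n| ^+ (d - 2))%:E = 1)%E.

End linear_boltzmann.

Arguments collision_kernel {R} d c gamma _ _.
Arguments normalization_constant {R} d c.

(* Main.v *)
(** For fixed v and unit n, put q = v - v_*. The post-collisional velocity
    v' = v - (q.n) n depends on q only through t = q.n, so after exchanging the
    integrals over v_* and n it is enough to compare, for every nonnegative G,
      int |q|^gamma xi^(d-2) M(v-q) G(q.n) dq  and
      int           xi^(d-2) M(v-q) G(q.n) dq.
    Let p be the component of q orthogonal to n. The map S doubling p (and fixing
    t) has Jacobian 2^(d-1), while xi^(d-2) decreases by at most 2^(d-2) under S.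
    Symmetrized under p -> -p, the Gaussian factor is exp(-|p|^2/(2 theta))
    cosh(p.(v - u)/theta) up to a function of t, and it decreases under S by at
    most exp(-3|p|^2/(2 theta)) >= 3/4 when |p|^2 <= theta/6. Hence the mass of
    {|p|^2 <= 2/3 theta} is at least 3/2 times that of {|p|^2 <= theta/6}, so a
    third of the total mass lies in {|p|^2 > theta/6}, where
    |q|^gamma >= (theta/6)^(gamma/2). *)

From HB Require Import structures.
Require Import Defs.
From mathcomp Require Import all_boot all_order all_algebra.
From mathcomp Require Import all_classical all_reals all_analysis.
From mathcomp Require Import measurable_realfun ring lra.

Set Implicit Arguments.
Unset Strict Implicit.
Unset Printing Implicit Defensive.

Import Order.TTheory GRing.Theory Num.Theory.
Import numFieldNormedType.Exports.

Local Open Scope classical_set_scope.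
Local Open Scope ring_scope.

(** * Lebesgue measure and linear maps *)

Section measurable_rV_ops.
Context {R : realType} {d : measure_display} {T : measurableType d} {n : nat}.
Implicit Types f g : T -> 'rV[R]_n.

Lemma measurable_coor f (i : 'I_n) : measurable_fun setT f ->
  measurable_fun setT (fun x => f x ord0 i).
Proof. by move=> /measurable_fun_rVP; exact. Qed.

Lemma measurable_rV_add f g : measurable_fun setT f -> measurable_fun setT g ->
  measurable_fun setT (fun x => f x + g x).
Proof.
move=> mf mg; apply/measurable_fun_rVP => i.
under eq_fun do rewrite mxE.
by apply: measurable_funD; exact: measurable_coor.
Qed.

Lemma measurable_rV_opp f : measurable_fun setT f ->
  measurable_fun setT (fun x => - f x).
Proof.
move=> mf; apply/measurable_fun_rVP => i.
under eq_fun do rewrite mxE.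
by apply: measurableT_comp => //; exact: measurable_coor.
Qed.

Lemma measurable_rV_scale (r : T -> R) f :
  measurable_fun setT r -> measurable_fun setT f ->
  measurable_fun setT (fun x => r x *: f x).
Proof.
move=> mr mf; apply/measurable_fun_rVP => i.
under eq_fun do rewrite mxE.
by apply: measurable_funM => //; exact: measurable_coor.
Qed.

Lemma measurable_dot f g : measurable_fun setT f -> measurable_fun setT g ->
  measurable_fun setT (fun x => dot (f x) (g x)).
Proof.
move=> mf mg; apply: measurable_sum => i.
by apply: measurable_funM; exact: measurable_coor.
Qed.

End measurable_rV_ops.

Lemma preimage_measurable {d1 d2} {T1 : measurableType d1}
    {T2 : measurableType d2} (f : T1 -> T2) (A : set T2) :
  measurable_fun setT f -> measurable A -> measurable (f @^-1` A).
Proof. by move=> mf mA; rewrite -[X in measurable X]setTI; exact: mf. Qed.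

Section lebesgue_translation.
Context {R : realType}.
Local Notation L := (@lebesgue_rV R).

Lemma lebesgue_measureD (a : R) (A : set R) : measurable A ->
  @lebesgue_measure R ((fun x : R => x + a) @^-1` A) = lebesgue_measure A.
Proof.
pose phi : measurableTypeR R -> measurableTypeR R := fun x => x + a.
have mphi : measurable_fun setT phi by exact: measurable_funD.
pose Phi : {mfun _ >-> _} := HB.pack phi (isMeasurableFun.Build _ _ _ _ _ mphi).
move=> mA; rewrite -[LHS]/(pushforward lebesgue_measure Phi A).
apply/esym/lebesgue_measure_unique => //= _ [[u v]] _ <-.
rewrite /pushforward/=.
rewrite (_ : phi @^-1` _ = `]u - a, v - a]%classic); last first.
  by apply/seteqP; split=> x /=; rewrite /phi !in_itv/= ltrBlDr lerBrDr.
rewrite !lebesgue_measure_itv/= !lte_fin ltrD2r -!EFinD.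
by rewrite opprB addrA subrK.
Qed.

(** Induction on [n]: the measure of [A] is the integral of the measures of its sections over the
    first coordinate. The induction hypothesis translates the sections, [lebesgue_measureD] the
    first coordinate. *)
Lemma lebesgue_rVD n (a : 'rV[R]_n) (A : set 'rV[R]_n) : measurable A ->
  L n ((fun x => x + a) @^-1` A) = L n A.
Proof.
elim: n a A => [|n IH] a A mA.
  by congr (L 0 _); apply/funext => x /=; rewrite [x + a]thinmx0 [x]thinmx0.
have mB : measurable (@rV_cons R n @^-1` A).
  by apply: preimage_measurable => //; exact: measurable_rV_cons.
set b : 'rV[R]_n := \row_i a ord0 (lift ord0 i).
set F := fun x => L n (xsection (@rV_cons R n @^-1` A) x).
have mF : measurable_fun setT F by exact: measurable_fun_xsection.
pose phi : measurableTypeR R -> measurableTypeR R := fun x => x + a ord0 ord0.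
have mphi : measurable_fun setT phi by exact: measurable_funD.
transitivity (\int[@lebesgue_measure R]_x F (phi x))%E.
  apply: eq_integral => x _; rewrite /= /F -(IH b); last first.
    exact: measurable_xsection.
  congr (L n _); rewrite !xsectionE; apply/funext => y /=; congr (A _).
  apply/rowP => i; rewrite !mxE.
  by case: unliftP => [j|] -> //=; rewrite !mxE.
rewrite -[LHS](ge0_integral_pushforward mphi lebesgue_measure measurableT mF)//.
by apply: eq_measure_integral => /= B mC _; exact: lebesgue_measureD.
Qed.

End lebesgue_translation.

Lemma integral_indicT {d} {T : measurableType d} {R : realType}
    (mu : {measure set T -> \bar R}) (A : set T) : measurable A ->
  (\int[mu]_x (\1_A x : R)%:E = mu A)%E.
Proof. by move=> mA; rewrite integral_indic// setIT. Qed.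

Lemma eq_indic {R : pzRingType} {T U : Type} (A : set T) (B : set U) x y :
  A x <-> B y -> \1_A x = \1_B y :> R.
Proof.
move=> AB; rewrite !indicE; congr (nat_of_bool _)%:R.
by apply/idP/idP; rewrite !inE => /AB.
Qed.

Section haar.
Context {R : realType} {n : nat}.
Local Notation L := (@lebesgue_rV R n).
Local Notation V := 'rV[R]_n.
Implicit Types A B : set V.

Let unit_cube : set V := [set x | forall i, `[0, 1]%classic (x ord0 i)].

Lemma measurable_box (I : 'I_n -> set R) : (forall i, measurable (I i)) ->
  measurable [set x : V | forall i, I i (x ord0 i)].
Proof.
move=> mI; rewrite (_ : [set _ | _] = \bigcap_(i in [set: 'I_n])
    ((fun x : V => x ord0 i) @^-1` I i)).
  apply: fin_bigcap_measurable; first exact: finite_finset.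
  by move=> i _; apply: preimage_measurable (mI i); exact: measurable_rV_coor.
by apply/seteqP; split=> x /= Ax; [move=> i _|move=> i]; exact: Ax.
Qed.

Let measurable_unit_cube : measurable unit_cube.
Proof. exact: (@measurable_box (fun=> `[0, 1]%classic) (fun=> measurable_itv _)). Qed.

Let lebesgue_unit_cube : L unit_cube = 1%E.
Proof.
rewrite [LHS](lebesgue_rV_box (fun=> measurable_itv `[0, 1])).
apply: big1 => i _.
by rewrite lebesgue_measure_itv/= lte_fin ltr01 oppr0 adde0.
Qed.

(* Both sides are the (mu x Lebesgue)-measure of
   {(x, y) | x \in A, x + y \in B}: integrate over y first, or substitute x - y
   for x and integrate over x last. *)
Lemma translation_invariant_measure_rV
    (mu : {sigma_finite_measure set V -> \bar R}) :
  (forall a A, measurable A -> mu ((fun x => x + a) @^-1` A) = mu A) ->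
  forall A B, measurable A -> measurable B ->
  (mu A * L B = mu B * L (-%R @^-1` A))%E.
Proof.
move=> mutr A B mA mB.
have mD : measurable_fun setT (fun z : V * V => z.1 + z.2).
  by apply: measurable_rV_add; [exact: measurable_fst|exact: measurable_snd].
have mS : measurable_fun setT (fun z : V * V => z.1 - z.2).
  apply: measurable_rV_add; [exact: measurable_fst|].
  by apply: measurable_rV_opp; exact: measurable_snd.
have mN : measurable_fun setT (fun z : V => - z).
  by apply: measurable_rV_opp; exact: measurable_id.
have mind (C : set (V * V)) : measurable C ->
    measurable_fun setT (fun z => (\1_C z : R)%:E).
  by move=> mC; apply/measurable_EFinP; exact: measurable_indic.
pose E := fst @^-1` A `&` (fun z : V * V => z.1 + z.2) @^-1` B.
pose F := fst @^-1` B `&` (fun z : V * V => z.1 - z.2) @^-1` A.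
have mE : measurable E.
  by apply: measurableI; apply: preimage_measurable; [exact: measurable_fst| |
    exact: mD|].
have mF : measurable F.
  by apply: measurableI; apply: preimage_measurable; [exact: measurable_fst| |
    exact: mS|].
have ind0 (C : set (V * V)) z : (0 <= (\1_C z : R)%:E)%E by rewrite lee_fin.
have EE := @fubini_tonelli _ _ _ _ _ mu L _ (mind E mE) (ind0 E).
have FF := @fubini_tonelli _ _ _ _ _ mu L _ (mind F mF) (ind0 F).
transitivity (\int[mu]_x \int[L]_y (\1_E (x, y) : R)%:E)%E.
  rewrite muleC -integral_cst// integral_mkcond.
  apply: eq_integral => x _; rewrite patchE; case: ifPn => xA.
    rewrite -[LHS](@lebesgue_rVD _ _ x)//.
    rewrite -[LHS]integral_indicT//; last first.
      by apply: preimage_measurable => //; exact: measurable_rV_add.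
    apply: eq_integral => y _; congr EFin; apply: eq_indic.
    by move: xA; rewrite /E /= inE addrC; split=> // -[].
  rewrite [RHS]integral0_eq// => y _.
  by rewrite indicE memNset// => -[] /= ?; rewrite notin_setE in xA.
rewrite EE; transitivity (\int[L]_y \int[mu]_x (\1_F (x, y) : R)%:E)%E.
  apply: eq_integral => y _.
  have mFy : measurable (ysection F y) by exact: measurable_ysection.
  have mEy : measurable (ysection E y) by exact: measurable_ysection.
  transitivity (mu (ysection E y)).
    rewrite -[RHS]integral_indicT//; apply: eq_integral => x _.
    by rewrite !indicE mem_ysection.
  transitivity (mu (ysection F y)).
    rewrite -[RHS](mutr y)//; congr (mu _); rewrite !ysectionE.
    apply/seteqP; split => x /=; rewrite /E /F /= addrK; by [case].
  rewrite -[LHS]integral_indicT//; apply: eq_integral => x _.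
  by rewrite !indicE mem_ysection.
rewrite -FF muleC -integral_cst// [RHS]integral_mkcond.
apply: eq_integral => x _; rewrite patchE; case: ifPn => xB.
  have mNA : measurable (-%R @^-1` A) by exact: preimage_measurable.
  rewrite -[RHS](@lebesgue_rVD _ _ (- x))//.
  rewrite -[RHS]integral_indicT//; last first.
    by apply: preimage_measurable => //; exact: measurable_rV_add.
  apply: eq_integral => y _; congr EFin; apply: eq_indic.
  by move: xB; rewrite /F /= inE opprB; split=> // -[].
rewrite [LHS]integral0_eq// => y _.
by rewrite indicE memNset// => -[] /= ?; rewrite notin_setE in xB.
Qed.

(** This is [translation_invariant_measure_rV] with [mu] the Lebesgue measure itself and [B] the
    unit cube, of measure one. *)
Lemma lebesgue_rVN A : measurable A -> L (-%R @^-1` A) = L A.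
Proof.
move=> mA; have tr a B := @lebesgue_rVD R n a B.
have := translation_invariant_measure_rV tr mA measurable_unit_cube.
by rewrite lebesgue_unit_cube mule1 mul1e.
Qed.

(** The pushforward of Lebesgue measure under [T] is translation invariant because [T] is additive
    and onto, so it is a multiple of Lebesgue measure; the factor is read off on the unit cube.
    Through [Ti] a sigma-finite cover is carried over to the pushforward. *)
Lemma lebesgue_rV_linear_preimage (T Ti : V -> V) :
  measurable_fun setT T -> measurable_fun setT Ti ->
  cancel T Ti -> cancel Ti T -> {morph T : x y / x + y} ->
  forall A, measurable A -> L (T @^-1` A) = (L (T @^-1` unit_cube) * L A)%E.
Proof.
move=> mT mTi TK TiK TD A mA.
pose m : {measure set V -> \bar R} := pushforward L T.
have sf : sigma_finite setT (m mT).
  have [F TF Foo] := sigma_finiteT L.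
  exists (fun k => Ti @^-1` F k).
    by rewrite -preimage_bigcup -TF preimage_setT.
  move=> k; have [mF Fk] := Foo k; split; first exact: preimage_measurable.
  rewrite /m/= /pushforward -comp_preimage (_ : _ \o _ = id) ?preimage_id//.
  exact/funext.
pose mu : {sigma_finite_measure set V -> \bar R} :=
  HB.pack (Measure.sort (m mT)) (Measure_isSigmaFinite.Build _ _ _ _ sf).
have tr a B : measurable B -> mu ((fun x => x + a) @^-1` B) = mu B.
  move=> mB; rewrite /mu/= /pushforward.
  rewrite -[RHS](@lebesgue_rVD _ _ (Ti a)); last exact: preimage_measurable.
  by congr (L _); apply/funext => x /=; rewrite TD TiK.
have := translation_invariant_measure_rV tr mA measurable_unit_cube.
by rewrite lebesgue_unit_cube mule1 lebesgue_rVN.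
Qed.

(** Applied twice, [T] scales volumes by the square of its factor; as [T] is then the identity, this
    nonnegative factor is 1. *)
Lemma lebesgue_rV_linear_involution (T : V -> V) :
  measurable_fun setT T -> involutive T -> {morph T : x y / x + y} ->
  forall A, measurable A -> L (T @^-1` A) = L A.
Proof.
move=> mT TT TD A mA.
have TE := lebesgue_rV_linear_preimage mT mT TT TT TD.
rewrite TE//; suff -> : L (T @^-1` unit_cube) = 1%E by rewrite mul1e.
have := TE _ (preimage_measurable mT measurable_unit_cube).
rewrite -comp_preimage (_ : T \o T = id) ?preimage_id; last exact/funext.
rewrite lebesgue_unit_cube.
have : (0 <= L (T @^-1` unit_cube))%E by exact: measure_ge0.
case: (L _) => [r| |]; [rewrite lee_fin => r0|by rewrite mulyy|by []].
move/esym; rewrite -EFinM => -[] /eqP.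
rewrite -expr2 sqrf_eq1 => /orP[/eqP->//|/eqP rN1].
by move: r0; rewrite rN1 oppr_ge0 ler10.
Qed.

End haar.

(** * Inner products, reflections in a line and dilations orthogonal to it *)

Section dot_theory.
Context {R : realType} {n : nat}.
Implicit Types (x y z : 'rV[R]_n) (a : R).

Lemma dotC x y : dot x y = dot y x.
Proof. by apply: eq_bigr => i _; rewrite mulrC. Qed.

Lemma dotDl x y z : dot (x + y) z = dot x z + dot y z.
Proof. by rewrite -big_split; apply: eq_bigr => i _; rewrite mxE mulrDl. Qed.

Lemma dotZl a x y : dot (a *: x) y = a * dot x y.
Proof. by rewrite mulr_sumr; apply: eq_bigr => i _; rewrite mxE mulrA. Qed.

Lemma dotNl x y : dot (- x) y = - dot x y.
Proof. by rewrite -scaleN1r dotZl mulN1r. Qed.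

Lemma dotDr x y z : dot z (x + y) = dot z x + dot z y.
Proof. by rewrite dotC dotDl !(dotC _ z). Qed.

Lemma dotZr a x y : dot x (a *: y) = a * dot x y.
Proof. by rewrite dotC dotZl dotC. Qed.

Lemma dotNr x y : dot x (- y) = - dot x y.
Proof. by rewrite dotC dotNl dotC. Qed.

Definition dotE := (dotDl, dotDr, dotZl, dotZr, dotNl, dotNr).

Lemma dot_ge0 x : 0 <= dot x x.
Proof. by apply: sumr_ge0 => i _; rewrite -expr2 sqr_ge0. Qed.

Lemma dot_eq0 x : (dot x x == 0) = (x == 0).
Proof.
apply/eqP/eqP => [x0|->]; last by rewrite -(scale0r 0) dotZl mul0r.
apply/rowP => i; rewrite mxE; apply/eqP; rewrite -sqrf_eq0 expr2; apply/eqP.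
by apply: (psumr_eq0P _ x0) => // j _; rewrite -expr2 sqr_ge0.
Qed.

Lemma sqr_enorm x : enorm x ^+ 2 = dot x x.
Proof. by rewrite sqr_sqrtr// dot_ge0. Qed.

Lemma enorm_eq1 x : enorm x = 1 -> dot x x = 1.
Proof. by move=> x1; rewrite -sqr_enorm x1 expr1n. Qed.

End dot_theory.

Section reflection_dilation.
Context {R : realType} {n : nat}.
Implicit Types (w x y : 'rV[R]_n).

(* The linear map equal to 1 on w and to -1 on the orthogonal of w; it is
   x |-> - x when w = 0, since 0^-1 = 0. *)
Definition axial_reflection w x := (2 * dot x w / dot w w) *: w - x.

(* The linear map equal to 1 on w and to 2 on the orthogonal of w, when w is a
   unit vector. *)
Definition normal_dilation w x := 2 *: x - dot x w *: w.

Lemma axial_reflectionD w : {morph axial_reflection w : x y / x + y}.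
Proof. by move=> x y; apply/rowP => i; rewrite !mxE dotE; ring. Qed.

Lemma axial_reflectionZ w a x :
  axial_reflection w (a *: x) = a *: axial_reflection w x.
Proof. by apply/rowP => i; rewrite !mxE dotE; ring. Qed.

Lemma axial_reflectionN w x : axial_reflection w (- x) = - axial_reflection w x.
Proof. by rewrite -scaleN1r axial_reflectionZ scaleN1r. Qed.

Lemma dot_axial_reflection w x y :
  dot (axial_reflection w x) (axial_reflection w y) = dot x y.
Proof.
have [->|w0] := eqVneq w 0.
  by rewrite /axial_reflection !scaler0 !sub0r dotNl dotNr opprK.
rewrite /axial_reflection !dotE (dotC w y); field.
by rewrite dot_eq0.
Qed.

Lemma axial_reflectionK w : involutive (axial_reflection w).
Proof.
move=> x; have [->|w0] := eqVneq w 0.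
  by rewrite /axial_reflection !scaler0 !sub0r opprK.
apply/rowP => i; rewrite /axial_reflection !dotE !mxE; field.
by rewrite dot_eq0.
Qed.

(** The line of [x + y] bisects the angle between the two unit vectors, so the reflection in it
    exchanges them. When [y = - x] the map is negation, which again sends [x] to [y]. *)
Lemma axial_reflection_bisector x y : dot x x = 1 -> dot y y = 1 ->
  axial_reflection (x + y) x = y.
Proof.
move=> x1 y1; have [xy0|xy0] := eqVneq (x + y) 0.
  rewrite /axial_reflection xy0 scaler0 sub0r.
  by rewrite -[LHS]addr0 -xy0 addKr.
have k1 : 2 * dot x (x + y) / dot (x + y) (x + y) = 1.
  move: xy0; rewrite -dot_eq0 !dotE x1 y1 (dotC y x) => xy0.
  by field.
by rewrite /axial_reflection k1 scale1r addrC addKr.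
Qed.

Lemma normal_dilationD w : {morph normal_dilation w : x y / x + y}.
Proof. by move=> x y; apply/rowP => i; rewrite !mxE dotE; ring. Qed.

Lemma dot_normal_dilation w x : dot w w = 1 ->
  dot (normal_dilation w x) w = dot x w.
Proof. by move=> w1; rewrite !dotE w1; ring. Qed.

Lemma dot_normal_dilation2 w x : dot w w = 1 ->
  dot (normal_dilation w x) (normal_dilation w x) =
  4 * dot x x - 3 * dot x w ^+ 2.
Proof. by move=> w1; rewrite !dotE w1 (dotC w x); ring. Qed.

Lemma axial_reflection_unit w x : dot w w = 1 ->
  axial_reflection w x = (2 * dot x w) *: w - x.
Proof. by move=> w1; rewrite /axial_reflection w1 divr1. Qed.

Lemma dot_axial_reflection_axis w x : dot w w = 1 ->
  dot (axial_reflection w x) w = dot x w.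
Proof. by move=> w1; rewrite axial_reflection_unit// !dotE w1; ring. Qed.

(** The inverse of [normal_dilation w] for a unit vector [w]: it fixes [w] and halves the vectors
    orthogonal to it. *)
Definition half_dilation w x := 2^-1 *: (x + dot x w *: w).

Lemma normal_dilationK w : dot w w = 1 ->
  cancel (normal_dilation w) (half_dilation w).
Proof.
move=> w1 x; apply/rowP => i; rewrite /half_dilation dot_normal_dilation//.
by rewrite !mxE; field.
Qed.

Lemma half_dilationK w : dot w w = 1 ->
  cancel (half_dilation w) (normal_dilation w).
Proof.
move=> w1 x; apply/rowP => i; rewrite /normal_dilation !dotE w1 !mxE.
by field.
Qed.

Lemma measurable_axial_reflection w : measurable_fun setT (axial_reflection w).
Proof.
apply: measurable_rV_add; last by apply: measurable_rV_opp; exact: measurable_id.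
apply: measurable_rV_scale => //; apply: measurable_funM => //.
apply: measurable_funM => //.
by apply: measurable_dot => //.
Qed.

Lemma measurable_normal_dilation w : measurable_fun setT (normal_dilation w).
Proof.
apply: measurable_rV_add; last apply: measurable_rV_opp.
  by apply: measurable_rV_scale => //.
apply: measurable_rV_scale => //.
by apply: measurable_dot => //.
Qed.

Lemma measurable_half_dilation w : measurable_fun setT (half_dilation w).
Proof.
apply: measurable_rV_scale => //; apply: measurable_rV_add => //.
apply: measurable_rV_scale => //.
by apply: measurable_dot => //.
Qed.

Lemma lebesgue_axial_reflection w A : measurable A ->
  lebesgue_rV n (axial_reflection w @^-1` A) = lebesgue_rV n A.
Proof.
apply: lebesgue_rV_linear_involution.
- exact: measurable_axial_reflection.
- exact: axial_reflectionK.
- exact: axial_reflectionD.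
Qed.

End reflection_dilation.

Section lebesgue_normal_dilation.
Context {R : realType} {n : nat}.
Implicit Types w : 'rV[R]_n.+1.

(* Conjugating by a reflection that exchanges w and the first basis vector
   reduces to a diagonal map. *)
Lemma lebesgue_normal_dilation w A : dot w w = 1 -> measurable A ->
  lebesgue_rV n.+1 (normal_dilation w @^-1` A) =
  ((2^-1 ^+ n)%:E * lebesgue_rV n.+1 A)%E.
Proof.
move=> w1 mA; pose e : 'rV[R]_n.+1 := delta_mx ord0 ord0.
have dote x : dot x e = x ord0 ord0.
  rewrite /dot big_ord_recl /= !mxE !eqxx mulr1 big1 ?addr0// => i _.
  by rewrite mxE eqxx /= mulr0.
have e1 : dot e e = 1 by rewrite dote mxE !eqxx.
pose U := axial_reflection (w + e).
have Uw : U w = e by exact: axial_reflection_bisector.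
(* [U] is an isometric involution taking [w] to [e], so it conjugates one dilation into the
   other. *)
have SE : normal_dilation w = U \o normal_dilation e \o U.
  apply/funext => x /=; rewrite /normal_dilation -Uw /U.
  rewrite axial_reflectionD axial_reflectionN !axial_reflectionZ.
  by rewrite !axial_reflectionK dot_axial_reflection.
rewrite SE comp_preimage lebesgue_axial_reflection; last first.
  rewrite comp_preimage.
  apply: (preimage_measurable (measurable_normal_dilation e)).
  exact: (preimage_measurable (measurable_axial_reflection _)).
rewrite comp_preimage.
rewrite (lebesgue_rV_linear_preimage (measurable_normal_dilation e)
  (measurable_half_dilation e) (normal_dilationK e1) (half_dilationK e1)
  (normal_dilationD e)); last first.
  exact: (preimage_measurable (measurable_axial_reflection _)).
rewrite lebesgue_axial_reflection//; congr (_ * _)%E.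
(* The remaining factor is the volume of the preimage of the unit cube under [normal_dilation e]: a
   box with one side 1 and [n] sides 1/2. *)
pose I (i : 'I_n.+1) : set R :=
  if i == ord0 then `[0, 1]%classic else `[0, 2^-1]%classic.
have mI i : measurable (I i) by rewrite /I; case: ifP => _; exact: measurable_itv.
transitivity (lebesgue_rV n.+1 [set x | forall i, I i (x ord0 i)]).
  congr (lebesgue_rV _ _); apply/seteqP.
  have i0P (i : 'I_n.+1) (x : 'rV[R]_n.+1) : (I i (x ord0 i)) <->
      `[0, 1]%classic (normal_dilation e x ord0 i).
    rewrite /I !mxE dote eqxx /=.
    case: (i =P ord0) => [->|_] /=; rewrite !in_itv/= ?(mulr1, mulr0, subr0).
      by rewrite mulr_natl mulr2n addrK.
    by split=> /andP[? ?]; apply/andP; split; lra.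
  by split => x /= Ix i; exact/i0P/Ix.
rewrite lebesgue_rV_box// big_ord_recl /I eqxx.
rewrite lebesgue_measure_itv/= lte_fin ltr01 oppr0 adde0 mul1e.
rewrite (eq_bigr (fun=> (2^-1)%:E)) => [|i _]; last first.
  by rewrite lebesgue_measure_itv/= lte_fin invr_gt0 ltr0n oppr0 adde0.
by rewrite prodEFin big_const iter_mulr mulr1 card_ord.
Qed.

End lebesgue_normal_dilation.

Section change_of_variables.
Context {R : realType} {n : nat}.
Local Notation V := 'rV[R]_n.
Local Notation L := (@lebesgue_rV R n).
Local Open Scope ereal_scope.

Lemma ge0_integral_preimage_scale (T : V -> V) (k : R)
    (F : V -> \bar R) :
  (0 <= k)%R ->
  measurable_fun setT T ->
  (forall A, measurable A -> L (T @^-1` A) = k%:E * L A) ->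
  measurable_fun setT F -> (forall x, 0 <= F x) ->
  \int[L]_x F (T x) = k%:E * \int[L]_x F x.
Proof.
move=> k0 mT TE mF F0.
transitivity (\int[pushforward L T]_x F x).
  by rewrite (ge0_integral_pushforward mT _ measurableT mF).
transitivity (\int[mscale (NngNum k0) L]_x F x); last by rewrite ge0_integral_mscale.
by apply: eq_measure_integral => A mA _; exact: TE.
Qed.

Lemma ge0_integral_axial_reflection w (F : V -> \bar R) :
  measurable_fun setT F -> (forall x, 0 <= F x) ->
  \int[L]_x F (axial_reflection w x) = \int[L]_x F x.
Proof.
move=> mF F0; rewrite -[RHS]mul1e.
apply: ge0_integral_preimage_scale => //.
  exact: measurable_axial_reflection.
by move=> A mA; rewrite mul1e lebesgue_axial_reflection.
Qed.

Lemma ge0_integral_subl (a : V) (F : V -> \bar R) :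
  measurable_fun setT F -> (forall x, 0 <= F x) ->
  \int[L]_x F (a - x)%R = \int[L]_x F x.
Proof.
move=> mF F0; rewrite -[RHS]mul1e.
have mN : measurable_fun setT (fun x : V => - x)%R.
  by apply: measurable_rV_opp; exact: measurable_id.
have mD : measurable_fun setT (fun x : V => x + a)%R.
  by apply: measurable_rV_add => //.
apply: (@ge0_integral_preimage_scale (fun x => a - x)%R) => //.
  by apply: measurable_rV_add.
move=> A mA; rewrite mul1e -(lebesgue_rVD a mA) -[RHS]lebesgue_rVN; last first.
  exact: preimage_measurable.
by congr (L _); apply/funext => x /=; rewrite addrC.
Qed.

End change_of_variables.

Lemma ge0_integral_normal_dilation {R : realType} {n : nat} (w : 'rV[R]_n.+1)
    (F : 'rV[R]_n.+1 -> \bar R) :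
  dot w w = 1 -> measurable_fun setT F -> (forall x, 0 <= F x)%E ->
  (\int[lebesgue_rV n.+1]_x F (normal_dilation w x) =
   (2^-1 ^+ n)%:E * \int[lebesgue_rV n.+1]_x F x)%E.
Proof.
move=> w1 mF F0.
have k0 : 0 <= 2^-1 ^+ n :> R by rewrite exprn_ge0// invr_ge0.
apply: ge0_integral_preimage_scale => //.
  exact: measurable_normal_dilation.
by move=> A mA; exact: lebesgue_normal_dilation.
Qed.

Lemma measurable_erestrict {d} {T : measurableType d} {R : realType}
    (D : set T) (g : T -> \bar R) :
  measurable D -> measurable_fun setT g -> measurable_fun setT (g \_ D).
Proof.
by move=> mD mg; apply/(measurable_restrictT _ mD); exact: measurable_funTS.
Qed.

(** * Mass near a line *)

Section perpendicular_mass.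
Context {R : realType} {n : nat}.
Local Notation V := 'rV[R]_n.+1.
Local Notation L := (@lebesgue_rV R n.+1).
Variable w : V.
Hypothesis w1 : dot w w = 1.

(** By Pythagoras, the squared distance from [x] to the line spanned by the unit vector [w]. *)
Definition perp2 (x : V) : R := dot x x - dot x w ^+ 2.

Lemma measurable_perp2 : measurable_fun setT perp2.
Proof.
apply: measurable_funB; first by apply: measurable_dot; exact: measurable_id.
by apply: measurable_funX; apply: measurable_dot => //; exact: measurable_id.
Qed.

Lemma perp2_ge0 x : 0 <= perp2 x.
Proof.
have := dot_ge0 (x - dot x w *: w); rewrite /perp2 !dotE w1 (dotC w x).
by congr (_ <= _); ring.
Qed.

Lemma perp2_axial_reflection x : perp2 (axial_reflection w x) = perp2 x.
Proof. by rewrite /perp2 dot_axial_reflection dot_axial_reflection_axis. Qed.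

Lemma perp2_normal_dilation x : perp2 (normal_dilation w x) = 4 * perp2 x.
Proof.
by rewrite /perp2 dot_normal_dilation2// dot_normal_dilation//; ring.
Qed.

(** A solid cylinder about the line of [w]; [rho] is the square of its radius, so doubling the
    distances to the axis multiplies it by 4. *)
Let near_axis rho := [set x | perp2 x <= rho].

Lemma measurable_near_axis rho : measurable (near_axis rho).
Proof.
rewrite (_ : near_axis rho = perp2 @^-1` `]-oo, rho]); last first.
  by apply/seteqP; split=> x /=; rewrite in_itv.
by apply: preimage_measurable; [exact: measurable_perp2|exact: measurable_itv].
Qed.

Lemma measurable_far_from_axis rho : measurable [set x | rho < perp2 x].
Proof.
rewrite (_ : [set _ | _] = perp2 @^-1` `]rho, +oo[); last first.
  by apply/seteqP; split=> x /=; rewrite in_itv/= andbT.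
by apply: preimage_measurable; [exact: measurable_perp2|exact: measurable_itv].
Qed.

Local Open Scope ereal_scope.

Lemma integral_near_axis_reflection rho (g : V -> \bar R) :
  measurable_fun setT g -> (forall x, 0 <= g x) ->
  \int[L]_(x in near_axis rho) g (axial_reflection w x) =
  \int[L]_(x in near_axis rho) g x.
Proof.
move=> mg g0; rewrite [RHS]integral_mkcond.
rewrite -(@ge0_integral_axial_reflection _ _ w); last 2 first.
- exact: measurable_erestrict (measurable_near_axis rho) mg.
- by move=> x; exact: erestrict_ge0.
rewrite integral_mkcond; apply: eq_integral => x _; rewrite !patchE.
by congr (if _ then _ else _); apply/idP/idP; rewrite !inE /near_axis /=
  perp2_axial_reflection.
Qed.

Lemma integral_near_axis_dilation rho (g : V -> \bar R) :
  measurable_fun setT g -> (forall x, 0 <= g x) ->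
  \int[L]_(x in near_axis rho) g (normal_dilation w x) =
  (2^-1 ^+ n)%:E * \int[L]_(x in near_axis (4 * rho)%R) g x.
Proof.
move=> mg g0; rewrite [in RHS]integral_mkcond.
rewrite -(@ge0_integral_normal_dilation _ _ w)//; last 2 first.
- exact: measurable_erestrict (measurable_near_axis _) mg.
- by move=> x; exact: erestrict_ge0.
rewrite integral_mkcond; apply: eq_integral => x _; rewrite !patchE.
by congr (if _ then _ else _); apply/idP/idP; rewrite !inE /near_axis /=
  perp2_normal_dilation ler_pM2l.
Qed.

(** Let a and b be the masses inside and outside [near_axis rho]. Integrated over this cylinder, the
    pointwise hypothesis bounds 3/2 a by the mass of [near_axis (4 * rho)], the Jacobian of the
    dilation cancelling [2^-1 ^+ n]. That mass is at most a + b; since a is finite, a <= 2 b, and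
    the total is at most 3 b. *)
Lemma integral_le_far_from_axis rho (g : V -> \bar R) : (0 <= rho)%R ->
  measurable_fun setT g -> (forall x, 0 <= g x) ->
  \int[L]_(x in [set x | (perp2 x <= rho)%R]) g x < +oo ->
  (forall x, (perp2 x <= rho)%R ->
    (3 / 2 * 2^-1 ^+ n)%:E * (g x + g (axial_reflection w x)) <=
    g (normal_dilation w x) +
      g (axial_reflection w (normal_dilation w x))) ->
  \int[L]_x g x <= 3%:E * \int[L]_(x in [set x | (rho < perp2 x)%R]) g x.
Proof.
move=> rho0 mg g0 a_fin ineq.
have mgR : measurable_fun setT (g \o axial_reflection w).
  by apply: measurableT_comp => //; exact: measurable_axial_reflection.
have mN := measurable_near_axis.
have mF := measurable_far_from_axis rho.
have mH : measurable_fun setT (fun x => g x + g (axial_reflection w x)).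
  exact: emeasurable_funD.
have H0 x : 0 <= g x + g (axial_reflection w x) by exact: adde_ge0.
have double r : \int[L]_(x in near_axis r) (g x + g (axial_reflection w x)) =
    2%:E * \int[L]_(x in near_axis r) g x.
  rewrite ge0_integralD//; [|exact: measurable_funTS..].
  by rewrite integral_near_axis_reflection// mule_natl mule2n.
set a := \int[L]_(x in near_axis rho) g x.
set b := \int[L]_(x in [set x | (rho < perp2 x)%R]) g x.
have a0 : 0 <= a by exact: integral_ge0.
have b0 : 0 <= b by exact: integral_ge0.
have total : \int[L]_x g x <= a + b.
  rewrite -ge0_integral_setU//; last first.
  - rewrite disj_set2E; apply/eqP/seteqP; split=> // x [] /=.
    by rewrite /near_axis/= leNgt => /negP.
  - exact: measurable_funTS.
  rewrite (_ : _ `|` _ = setT)//; apply/seteqP; split=> // x _ /=.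
  by rewrite /near_axis/=; have [|] := leP (perp2 x) rho; [left|right].
have near4 : \int[L]_(x in near_axis (4 * rho)%R) g x <= a + b.
  apply: le_trans _ total.
  by apply: ge0_subset_integral.
have q0 : (0 < 2^-1 ^+ n :> R)%R by rewrite exprn_gt0// invr_gt0.
have key : (3 / 2 * 2^-1 ^+ n)%:E * (2%:E * a) <=
    (2^-1 ^+ n)%:E * (2%:E * (a + b)).
  apply: (@le_trans _ _ ((2^-1 ^+ n)%:E *
      (2%:E * \int[L]_(x in near_axis (4 * rho)%R) g x))); last first.
    by rewrite !lee_pmul2l// ?lte_fin.
  rewrite -!double -integral_near_axis_dilation// -ge0_integralZl_EFin//;
    last exact: measurable_funTS.
  apply: ge0_le_integral => //.
  - by move=> x _; rewrite mule_ge0// lee_fin ltW// mulr_gt0// divr_gt0.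
  - by apply: measurable_funeM; exact: measurable_funTS.
  - apply: measurable_funTS.
    exact: (measurableT_comp mH (measurable_normal_dilation w)).
clear near4; move: a_fin a0 b0 total key; rewrite -/(near_axis rho) -/a.
case: a => [r| |]//; case: b => [s| |]//=; last first.
  by move=> *; rewrite gt0_muley ?leey// lte_fin.
rewrite -!EFinD -!EFinM !lee_fin => _ r0 s0 gl key.
apply: le_trans gl _; rewrite lee_fin.
rewrite -(ler_pM2l q0); move: key; nra.
Qed.

End perpendicular_mass.

Section truncation.
Context {R : realType}.
Implicit Types (G : R -> \bar R) (k : nat) (t : R).
Local Open Scope ereal_scope.

(* The mass near the axis is subtracted from both sides of the comparison in
   [integral_le_far_from_axis], so it has to be finite, while G may take the
   value +oo. *)
Definition truncate G k t : \bar R :=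
  if (`|t| <= k%:R)%R then mine (G t) k%:R%:E else 0.

Lemma truncate_ge0 G k t : (forall t, 0 <= G t) -> 0 <= truncate G k t.
Proof.
by move=> G0; rewrite /truncate; case: ifPn => // _; rewrite le_min G0 lee_fin /=.
Qed.

Lemma truncate_le_id G k t : (forall t, 0 <= G t) -> truncate G k t <= G t.
Proof. by move=> G0; rewrite /truncate; case: ifPn => // _; rewrite ge_min lexx. Qed.

Lemma truncate_nd G t : (forall t, 0 <= G t) ->
  nondecreasing_seq (truncate G ^~ t).
Proof.
move=> G0 i j ij; rewrite /truncate.
have ijR : (i%:R <= j%:R :> R)%R by rewrite ler_nat.
case: ifPn => ti; last exact: truncate_ge0.
rewrite (le_trans ti ijR); apply: le_min2 => //.
Qed.

(** If [G t] is finite, the truncation is eventually inactive; if it is infinite, the truncated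
    value is eventually [k]. *)
Lemma cvg_truncate G t : (forall t, 0 <= G t) ->
  truncate G k t @[k --> \oo] --> G t.
Proof.
move=> G0.
have evl (a : R) : \forall k \near \oo, (a <= k%:R)%R by exact: nbhs_infty_ger.
case Gt : (G t) => [r| |]; last by have := G0 t; rewrite Gt.
- apply: cvg_near_cst; near=> k.
  rewrite /truncate Gt ifT; last by near: k; exact: evl.
  by apply/min_idPl; rewrite lee_fin; near: k; exact: evl.
- have : k%:R%:E @[k --> \oo] --> (+oo : \bar R) by exact/cvgenyP.
  apply: cvg_trans; apply: near_eq_cvg; near=> k.
  rewrite /truncate Gt ifT; last by near: k; exact: evl.
  by apply/esym/min_idPr; rewrite leey.
Unshelve. all: by end_near. Qed.

Lemma measurable_truncate G k : measurable_fun setT G ->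
  measurable_fun setT (truncate G k).
Proof.
move=> mG; apply: measurable_fun_ifT => //.
- by apply: measurable_fun_ler => //; exact: measurableT_comp.
- exact: measurable_mine.
Qed.

End truncation.

Section weighted.
Context {R : realType} {n : nat}.
Local Notation V := 'rV[R]_n.+1.
Local Notation L := (@lebesgue_rV R n.+1).
Local Open Scope ereal_scope.

Lemma lebesgue_bounded_lty (r : R) (A : set V) : measurable A ->
  (forall x, A x -> (dot x x <= r)%R) -> L A < +oo.
Proof.
(* From [0 <= y] and [y ^+ 2 <= r] follows [y <= r + 1], which avoids a square root. *)
move=> mA Ar; pose I (i : 'I_n.+1) : set R := `[(- (r + 1))%R, (r + 1)%R]%classic.
have mI i : measurable (I i) by exact: measurable_itv.
apply: (@le_lt_trans _ _ (L [set x | forall i, I i (x ord0 i)])).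
  apply: le_measure; rewrite ?inE//; first exact: measurable_box.
  move=> x /Ar xr i; rewrite /I/= in_itv/= -ler_norml.
  have : (`|x ord0 i| ^+ 2 <= r)%R.
    apply: le_trans xr; rewrite real_normK ?num_real// /dot (bigD1 i)//= -expr2.
    by rewrite lerDl sumr_ge0// => j _; rewrite -expr2 sqr_ge0.
  have := normr_ge0 (x ord0 i); nra.
rewrite lebesgue_rV_box//.
rewrite (eq_bigr (fun=> (Num.max (r + 1 - - (r + 1)) 0)%R%:E)) => [|i _]; last first.
  rewrite lebesgue_measure_itv/= lte_fin; case: ltP => // h.
    by rewrite -EFinD; congr EFin; rewrite max_l//; lra.
  by congr EFin; rewrite max_r//; lra.
by rewrite prodEFin ltry.
Qed.

(** The reflection and the dilation both preserve [dot x w], hence the factor [G (dot x w)], so the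
    pointwise inequality is a condition on [p] alone. With [G] truncated and [p] bounded by [K] the
    mass near the axis is finite; monotone convergence then removes the truncation. *)
Lemma weighted_integral_le_far_from_axis (w : V) (rho K : R) (p : V -> R)
    (G : R -> \bar R) :
  dot w w = 1%R -> (0 <= rho)%R ->
  measurable_fun setT p -> (forall x, 0 <= p x <= K)%R ->
  measurable_fun setT G -> (forall t, 0 <= G t) ->
  (forall x, perp2 w x <= rho ->
    3 / 2 * 2^-1 ^+ n * (p x + p (axial_reflection w x)) <=
    p (normal_dilation w x) +
      p (axial_reflection w (normal_dilation w x)))%R ->
  \int[L]_x ((p x)%:E * G (dot x w)) <=
  3%:E * \int[L]_(x in [set x | (rho < perp2 w x)%R]) ((p x)%:E * G (dot x w)).
Proof.
move=> w1 rho0 mp pK mG G0 ineq.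
have p0 x : 0 <= (p x)%:E by rewrite lee_fin; have /andP[] := pK x.
have mdot : measurable_fun setT (fun x : V => dot x w).
  by apply: measurable_dot => //.
have mpE : measurable_fun setT (fun x => (p x)%:E).
  exact: measurableT_comp.
pose g k x := (p x)%:E * truncate G k (dot x w).
have g0 k x : 0 <= g k x by rewrite mule_ge0// truncate_ge0.
have mg k : measurable_fun setT (g k).
  apply: emeasurable_funM => //; apply: measurableT_comp => //.
  exact: measurable_truncate.
have mgG : measurable_fun setT (fun x => (p x)%:E * G (dot x w)).
  by apply: emeasurable_funM => //; exact: measurableT_comp.
have cvg_g x : g k x @[k --> \oo] --> (p x)%:E * G (dot x w).
  by apply: cvgeZl => //; exact: cvg_truncate.
have nd_g x : nondecreasing_seq (g ^~ x).
  by move=> i j ij; apply: lee_wpmul2l => //; exact: truncate_nd.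
have mF := measurable_far_from_axis w rho.
have mN : measurable [set x | (perp2 w x <= rho)%R].
  exact: measurable_near_axis.
have -> : \int[L]_x ((p x)%:E * G (dot x w)) = \int[L]_x limn (g ^~ x).
  by apply: eq_integral => x _; apply/esym/cvg_lim.
have := @cvg_monotone_convergence _ _ _ L _ measurableT g mg
  (fun k x _ => g0 k x) (fun x _ => nd_g x).
apply: cvge_le; near=> k.
apply: (@le_trans _ _ (3%:E * \int[L]_(x in [set x | (rho < perp2 w x)%R]) g k x)).
  apply: integral_le_far_from_axis => //.
  (* Within the cylinder the truncated integrand vanishes outside [D], and on [D] it is at most
     [K * k%:R]. The set [D] is bounded, as [dot x x] is [perp2 w x] plus the square of
     [dot x w]. *)
  - pose D := [set x | (perp2 w x <= rho)%R] `&` [set x | (`|dot x w| <= k%:R)%R].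
    have mD : measurable D.
      apply: measurableI => //.
      rewrite (_ : [set _ | _] = (fun x : V => dot x w) @^-1` `[(- k%:R)%R, k%:R%R]).
        by apply: preimage_measurable => //; exact: measurable_itv.
      by apply/seteqP; split=> x /=; rewrite in_itv/= ler_norml.
    have K0 : (0 <= K)%R by have /andP[a b] := pK 0%R; exact: le_trans a b.
    apply: (@le_lt_trans _ _ (\int[L]_(x in D) (cst (K * k%:R)%:E) x)).
      rewrite integral_mkcond [leRHS]integral_mkcond.
      apply: ge0_le_integral => //.
      + by move=> x _; apply: erestrict_ge0.
      + exact: measurable_erestrict.
      + exact: measurable_erestrict.
      move=> x _; rewrite !patchE; case: ifPn => xN; last first.
        by case: ifPn => // _; rewrite lee_fin mulr_ge0.
      rewrite /g /truncate; case: ifPn => xk.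
        rewrite mem_set ?EFinM; last by split=> //; move: xN; rewrite inE.
        apply: lee_pmul => //.
        + by rewrite le_min G0 lee_fin ler0n.
        + by rewrite lee_fin; have /andP[] := pK x.
        + by rewrite ge_min lexx orbT.
      by rewrite mule0; case: ifPn => // _; rewrite lee_fin mulr_ge0.
    rewrite integral_cst// lte_mul_pinfty ?lee_fin ?mulr_ge0//.
    apply: (@lebesgue_bounded_lty (rho + k%:R ^+ 2)) => // x [] /=.
    rewrite /perp2 => xN xk.
    have : (`|dot x w| ^+ 2 <= k%:R ^+ 2)%R by rewrite lerXn2r// nnegrE.
    by rewrite real_normK ?num_real//; move: xN; lra.
  - move=> x xN; have := ineq x xN; rewrite /g !dot_axial_reflection_axis//.
    rewrite dot_normal_dilation// -!ge0_muleDl// muleA => pineq.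
    apply: lee_wpmul2r; first exact: truncate_ge0.
    by rewrite -!EFinD -EFinM lee_fin.
rewrite lee_pmul2l// ?lte_fin//; apply: ge0_le_integral => //.
- exact: measurable_funTS.
- exact: measurable_funTS.
- by move=> x _; apply: lee_wpmul2l => //; exact: truncate_le_id.
Unshelve. all: by end_near. Qed.

End weighted.

(** * The Maxwellian weight *)

Section gaussian_weight.
Context {R : realType} {n : nat}.
Local Notation V := 'rV[R]_n.+1.
Variables (w : V) (theta : R) (u v : V).
Hypotheses (w1 : dot w w = 1) (theta0 : 0 < theta).

Lemma sqr_dot_le (x : V) : dot x w ^+ 2 <= dot x x.
Proof. by have := perp2_ge0 w1 x; rewrite /perp2 subr_ge0. Qed.

Lemma normr_dot_le (x : V) : `|dot x w| <= enorm x.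
Proof. by rewrite -sqrtr_sqr ler_wsqrtr// sqr_dot_le. Qed.

Lemma cosine_ge0 (x : V) : 0 <= `|dot x w| / enorm x.
Proof. by rewrite divr_ge0// enorm_ge0. Qed.

Lemma cosine_le1 (x : V) : `|dot x w| / enorm x <= 1.
Proof.
have := enorm_ge0 x; rewrite le_eqVlt => /predU1P[<-|x0].
  by rewrite invr0 mulr0.
by rewrite ler_pdivrMr// mul1r normr_dot_le.
Qed.

Lemma cosine_axial_reflection (x : V) :
  `|dot (axial_reflection w x) w| / enorm (axial_reflection w x) =
  `|dot x w| / enorm x.
Proof. by rewrite dot_axial_reflection_axis// /enorm dot_axial_reflection. Qed.

(** The dilation preserves [dot x w] and at most doubles the norm, whose square becomes
    [4 * dot x x - 3 * dot x w ^+ 2]. *)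
Lemma cosine_normal_dilation (x : V) :
  2^-1 * (`|dot x w| / enorm x) <=
  `|dot (normal_dilation w x) w| / enorm (normal_dilation w x).
Proof.
rewrite dot_normal_dilation//.
have := enorm_ge0 x; rewrite le_eqVlt => /predU1P[<-|x0].
  by rewrite invr0 !mulr0 divr_ge0// enorm_ge0.
have xw := sqr_dot_le x; have d0 := sqr_enorm x.
have Sx0 : 0 < enorm (normal_dilation w x).
  by rewrite sqrtr_gt0 dot_normal_dilation2//; nra.
rewrite mulrCA ler_wpM2l// -invfM lef_pV2 ?posrE ?mulr_gt0//.
rewrite -(ler_pXn2r (ltn0Sn 1)) ?nnegrE ?mulr_ge0 ?enorm_ge0// exprMn.
by rewrite !sqr_enorm dot_normal_dilation2//; have := sqr_ge0 (dot x w); lra.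
Qed.

(** This is cosh b <= cosh (2 b). With s = e^b + e^(-b) >= 2 the right side is s^2 - 2, which is at
    least s. *)
Lemma expRD_expRN_le_double (b : R) :
  expR b + expR (- b) <= expR (2 * b) + expR (- (2 * b)).
Proof.
rewrite mulr_natl mulr2n opprD !expRD.
have yz : expR b * expR (- b) = 1 by rewrite -expRD subrr expR0.
have := expR_gt0 b; have := expR_gt0 (- b); move: yz.
move: (expR b) (expR (- b)) => y z yz z0 y0.
have yz2 : 2 <= y + z by have := sqr_ge0 (y - z); nra.
by have := sqr_ge0 (y - z); nra.
Qed.

(** Up to a common exponential the two sums are hyperbolic cosines, of [b] on the left and of
    [2 * b] on the right. The dilation also costs the factor [expR e1], which is at least 3/4 near
    the axis. *)
Lemma maxwellian_normal_dilation (x : V) : perp2 w x <= theta / 6 ->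
  3 / 4 * (maxwellian theta u (v - x) +
           maxwellian theta u (v - axial_reflection w x)) <=
  maxwellian theta u (v - normal_dilation w x) +
  maxwellian theta u (v - axial_reflection w (normal_dilation w x)).
Proof.
move=> xP; rewrite /maxwellian !sqr_enorm.
have vE y : v - y - u = (v - u) - y by rewrite addrAC.
rewrite !vE; move: (v - u) => a; set A := (2 * pi * theta) `^ _.
(* [b] is the inner product of the components of [a] and [x] orthogonal to [w], over [theta]. The
   reflection changes its sign and keeps [e0]; the dilation doubles it and adds [e1] to the
   exponent. *)
pose t := dot x w; pose al := dot a w; pose b := (dot a x - t * al) / theta.
pose e0 := - ((dot a a - 2 * t * al + dot x x) / (2 * theta)).
pose e1 := - (3 * perp2 w x / (2 * theta)).
have th0 : theta != 0 by rewrite gt_eqF.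
have -> : - (dot (a - x) (a - x) / (2 * theta)) = e0 + b.
  by rewrite /e0 /b !dotE (dotC x a); field.
have -> : - (dot (a - axial_reflection w x) (a - axial_reflection w x) /
    (2 * theta)) = e0 - b.
  rewrite axial_reflection_unit// /e0 /b /t /al !dotE w1.
  by rewrite (dotC x a) (dotC w a) (dotC w x); field.
have -> : - (dot (a - normal_dilation w x) (a - normal_dilation w x) /
    (2 * theta)) = e0 + e1 + 2 * b.
  rewrite /normal_dilation /e0 /e1 /b /t /al /perp2 !dotE w1.
  by rewrite (dotC x a) (dotC w a) (dotC w x); field.
have -> : - (dot (a - axial_reflection w (normal_dilation w x))
    (a - axial_reflection w (normal_dilation w x)) / (2 * theta)) =
    e0 + e1 - 2 * b.
  rewrite axial_reflection_unit// dot_normal_dilation//.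
  rewrite /normal_dilation /e0 /e1 /b /t /al /perp2 !dotE w1.
  by rewrite (dotC x a) (dotC w a) (dotC w x); field.
rewrite !expRD -!mulrDr mulrCA ler_wpM2l ?powR_ge0//.
rewrite mulrCA -mulrA ler_wpM2l ?expR_ge0//.
apply: ler_pM => //; last exact: expRD_expRN_le_double.
(* The tangent bound [1 + e1 <= expR e1] suffices, because [perp2 w x <= theta / 6] gives
   [- 4^-1 <= e1]. *)
apply: le_trans (expR_ge1Dx e1).
suff : 3 * perp2 w x / (2 * theta) <= 4^-1 by rewrite /e1; lra.
by rewrite ler_pdivrMr ?mulr_gt0//; move: xP; lra.
Qed.

Lemma measurable_cosine d (T : measurableType d) (f g : T -> V) :
  measurable_fun setT f -> measurable_fun setT g ->
  measurable_fun setT (fun x => `|dot (f x) (g x)| / enorm (f x)).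
Proof.
move=> mf mg; apply: measurable_funM.
  by apply: measurableT_comp => //; exact: measurable_dot.
under eq_fun do rewrite -powR_inv1 ?enorm_ge0//.
apply: (measurableT_comp (measurable_powR (- 1))).
exact: (measurableT_comp measurable_enorm).
Qed.

Lemma measurable_maxwellian d (T : measurableType d) (f : T -> V) :
  measurable_fun setT f ->
  measurable_fun setT (fun x => maxwellian theta u (f x)).
Proof.
move=> mf; apply: measurable_funM => //; apply: measurableT_comp => //.
apply: measurableT_comp => //; apply: measurable_funM => //.
apply: measurable_funX; apply: (measurableT_comp measurable_enorm).
by apply: measurable_rV_add.
Qed.

Lemma maxwellian_gt0 (x : V) : 0 < maxwellian theta u x.
Proof. by rewrite mulr_gt0 ?expR_gt0// powR_gt0// !mulr_gt0// pi_gt0. Qed.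

Lemma maxwellian_le (x : V) :
  maxwellian theta u x <= (2 * pi * theta) `^ (- (n.+1%:R / 2)).
Proof.
rewrite ler_piMr ?powR_ge0// -expR0 ler_expR oppr_le0.
by rewrite divr_ge0 ?sqr_ge0// mulr_ge0// ltW.
Qed.

End gaussian_weight.


Section collision_weight.
Context {R : realType} {m : nat}.
Local Notation V := 'rV[R]_m.+2.
Local Notation L := (@lebesgue_rV R m.+2).
Variables (w : V) (theta : R) (u v : V).
Hypotheses (w1 : dot w w = 1) (theta0 : 0 < theta).

(** Here [m] is d - 2 and [x] is the relative velocity: [p] is the angular part of the kernel times
    the Maxwellian at the second velocity [v - x]. *)
Let p (x : V) := (`|dot x w| / enorm x) ^+ m * maxwellian theta u (v - x).

(** The angular factor, unchanged by the reflection, keeps at least [2^-1 ^+ m] of its value and the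
    symmetrized Maxwellian at least 3/4. Relative to the Jacobian [2^-1 ^+ m.+1] this is a gain of
    3/2, since [m] is one less than the dimension of the orthogonal complement of [w]. *)
Lemma collision_weight_normal_dilation (x : V) : perp2 w x <= theta / 6 ->
  3 / 2 * 2^-1 ^+ m.+1 * (p x + p (axial_reflection w x)) <=
  p (normal_dilation w x) + p (axial_reflection w (normal_dilation w x)).
Proof.
move=> xP; rewrite /p (cosine_axial_reflection w1 x).
rewrite (cosine_axial_reflection w1 (normal_dilation w x)).
rewrite -[X in _ * X <= _]mulrDr -[leRHS]mulrDr.
rewrite (_ : 3 / 2 * 2^-1 ^+ m.+1 = 2^-1 ^+ m * (3 / 4)); last first.
  by rewrite exprS; move: (2^-1 ^+ m) => q; field.
rewrite mulrACA -exprMn; apply: ler_pM.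
- by rewrite exprn_ge0// mulr_ge0 ?invr_ge0// cosine_ge0.
- apply: mulr_ge0; first exact: divr_ge0.
  by apply: addr_ge0; apply/ltW/maxwellian_gt0.
- apply: lerXn2r; rewrite ?nnegrE.
  + by apply: mulr_ge0; [rewrite invr_ge0|exact: cosine_ge0].
  + exact: cosine_ge0.
  + exact: cosine_normal_dilation.
- exact: maxwellian_normal_dilation.
Qed.

Local Open Scope ereal_scope.

(** Where [rho < perp2 w x] also [rho < dot x x], so |x|^gamma is at least rho^(gamma/2). By
    [weighted_integral_le_far_from_axis] that region carries at least a third of the integral
    without this power. *)
Lemma collision_weight_integral_le (gamma k : R) (G : R -> \bar R) :
  (0 <= gamma)%R -> (0 <= k)%R ->
  measurable_fun setT G -> (forall t, 0 <= G t) ->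
  ((6^-1 `^ (gamma / 2) / 3)%R * theta `^ (gamma / 2))%:E *
    \int[L]_x ((k * p x)%:E * G (dot x w)) <=
  \int[L]_x ((k * enorm x `^ gamma * p x)%:E * G (dot x w)).
Proof.
move=> gamma0 k0 mG G0; pose rho := (theta / 6)%R.
have rho0 : (0 < rho)%R by rewrite divr_gt0.
have p0 x : (0 <= p x)%R.
  by rewrite mulr_ge0 ?exprn_ge0 ?cosine_ge0// ltW// maxwellian_gt0.
have mp : measurable_fun setT p.
  apply: measurable_funM; first by apply/measurable_funX/measurable_cosine.
  apply: measurable_maxwellian; apply: measurable_rV_add => //.
  exact: measurable_rV_opp.
have mGw : measurable_fun setT (fun x : V => G (dot x w)).
  by apply: measurableT_comp => //; exact: measurable_dot.
have me : measurable_fun setT (fun x : V => enorm x `^ gamma)%R.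
  exact: (measurableT_comp (measurable_powR gamma) measurable_enorm).
have m1 : measurable_fun setT (fun x => (k * p x)%:E * G (dot x w)).
  by apply: emeasurable_funM => //; apply: measurableT_comp => //;
    exact: measurable_funM.
have m2 : measurable_fun setT
    (fun x => (k * enorm x `^ gamma * p x)%:E * G (dot x w)).
  by apply: emeasurable_funM => //; apply: measurableT_comp => //;
    apply: measurable_funM => //; exact: measurable_funM.
have mF := measurable_far_from_axis w rho.
have -> : (6^-1 `^ (gamma / 2) / 3 * theta `^ (gamma / 2) =
    rho `^ (gamma / 2) * 3^-1)%R.
  by rewrite /rho powRM ?invr_ge0//; [ring|exact: ltW].
have far : \int[L]_x ((k * p x)%:E * G (dot x w)) <=
    3%:E * \int[L]_(x in [set x | (rho < perp2 w x)%R])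
      ((k * p x)%:E * G (dot x w)).
  apply: (@weighted_integral_le_far_from_axis _ _ _ _
    (k * (2 * pi * theta) `^ (- (m.+2%:R / 2)))) => //.
  - exact: ltW.
  - exact: measurable_funM.
  - move=> x; rewrite mulr_ge0//= ler_wpM2l// /p.
    rewrite -[leRHS]mul1r ler_pM ?exprn_ge0 ?cosine_ge0//.
    + by rewrite ltW// maxwellian_gt0.
    + by rewrite exprn_ile1 ?cosine_ge0 ?cosine_le1.
    + exact: maxwellian_le.
  - move=> x /collision_weight_normal_dilation.
    move: (p x) (p _) (p _) (p _) (3 / 2 * _)%R => a b c e q ineq.
    by rewrite -mulrDr -[leRHS]mulrDr mulrCA ler_wpM2l.
apply: (@le_trans _ _ (\int[L]_(x in [set x | (rho < perp2 w x)%R])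
    ((k * enorm x `^ gamma * p x)%:E * G (dot x w)))); last first.
  apply: ge0_subset_integral => // x _.
  apply: mule_ge0 => //; rewrite lee_fin; do 2 apply: mulr_ge0 => //.
  exact: powR_ge0.
apply: (@le_trans _ _ ((rho `^ (gamma / 2))%:E *
    \int[L]_(x in [set x | (rho < perp2 w x)%R])
      ((k * p x)%:E * G (dot x w)))); last first.
  rewrite -ge0_integralZl_EFin//; last 3 first.
  - by move=> x _; rewrite mule_ge0// lee_fin mulr_ge0.
  - exact: measurable_funTS.
  - exact: powR_ge0.
  apply: ge0_le_integral => //.
  - by move=> x _; rewrite !mule_ge0// lee_fin ?powR_ge0// mulr_ge0.
  - by apply: measurable_funeM; exact: measurable_funTS.
  - exact: measurable_funTS.
  move=> x /= xrho; rewrite muleA -EFinM lee_wpmul2r// lee_fin.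
  rewrite mulrCA -mulrA ler_wpM2l// ler_wpM2r//.
  (* Written with the nonnegative exponent [gamma / 2], the power is monotone in the squared norm,
     which can be compared with [rho]. *)
  have -> : (enorm x `^ gamma = dot x x `^ (gamma / 2))%R.
    rewrite -sqr_enorm -powR_mulrn ?enorm_ge0// -powRrM.
    by congr (_ `^ _)%R; field.
  apply: ge0_ler_powR; rewrite ?nnegrE; [exact: divr_ge0|exact: ltW|
    exact: dot_ge0|].
  by apply: (le_trans (ltW xrho)); rewrite /perp2 gerBl sqr_ge0.
rewrite EFinM -muleA lee_wpmul2l ?lee_fin ?powR_ge0//.
rewrite -(@lee_pmul2l _ 3%:E) ?lte_fin// muleA -EFinM mulfV// mul1e.
exact: far.
Qed.

End collision_weight.

(** * Exchange of the integrals *)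

Section sphere_measure_finite.
Context {R : realType} {n : nat}.
Local Open Scope ereal_scope.

Lemma measurable_sphere : measurable (sphere R n).
Proof.
rewrite (_ : sphere R n = enorm @^-1` [set 1%R])//.
by apply: preimage_measurable; [exact: measurable_enorm|exact: measurable_set1].
Qed.

(** Tonelli's theorem asks for sigma-finite measures. The total mass here is the dimension times the
    volume of the punctured unit ball, a bounded set. *)
Lemma sphere_measure_fin_num : fin_num_fun (sphere_measure R n.+1).
Proof.
move=> A mA; rewrite ge0_fin_numE//.
apply: (@le_lt_trans _ _ (sphere_measure R n.+1 setT)).
  by apply: le_measure; rewrite ?inE.
rewrite /sphere_measure /pushforward preimage_setT /mscale/= /mrestr setTI.
apply: lte_mul_pinfty => //.
apply: (@lebesgue_bounded_lty _ _ 1%R); first exact: measurable_punctured_ball.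
move=> x /andP[_ x1]; rewrite -sqr_enorm.
by rewrite -[leRHS](expr1n _ 2) lerXn2r ?nnegrE ?enorm_ge0.
Qed.

End sphere_measure_finite.

HB.instance Definition _ (R : realType) (n : nat) :=
  Measure_isFinite.Build _ _ _ (sphere_measure R n.+1) sphere_measure_fin_num.

Section Psi_theory.
Context {R : realType}.

Lemma Psi_ge0 (x y : R) : 0 <= x -> 0 <= y -> (0 <= Psi x y)%E.
Proof.
move=> x0 y0; rewrite /Psi; case: ifPn => // _; case: ifPn => //.
rewrite negb_or lee_fin => /andP[xN0 yN0].
have xp : 0 < x by rewrite lt_def xN0.
have yp : 0 < y by rewrite lt_def yN0.
have [xy|yx] := leP x y.
  by rewrite mulr_le0// subr_le0// ler_ln.
by rewrite mulr_ge0// subr_ge0 ?ler_ln// ltW.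
Qed.

Lemma measurable_Psi d (T : measurableType d) (f g : T -> R) :
  measurable_fun setT f -> measurable_fun setT g ->
  measurable_fun setT (fun x => Psi (f x) (g x)).
Proof.
move=> mf mg.
have mf0 : measurable_fun setT (fun x => f x == 0) by exact: measurable_fun_eqr.
have mg0 : measurable_fun setT (fun x => g x == 0) by exact: measurable_fun_eqr.
apply: measurable_fun_ifT => //; first exact: measurable_and.
apply: measurable_fun_ifT => //; first exact: measurable_or.
apply: measurableT_comp => //; apply: measurable_funM.
  exact: measurable_funB.
by apply: measurable_funB; apply: measurableT_comp => //; exact: measurable_ln.
Qed.

End Psi_theory.

Section iterated_integrals.
Context {R : realType} {d1 d2 d3 : measure_display} {T1 : measurableType d1}
  {T2 : measurableType d2} {T3 : measurableType d3}.
Variables (m1 : {sigma_finite_measure set T1 -> \bar R})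
  (m2 : {sigma_finite_measure set T2 -> \bar R})
  (m3 : {sigma_finite_measure set T3 -> \bar R}).
Local Open Scope ereal_scope.

(** The hypothesis compares integrals over [y] for fixed [x] and [z], so for each [x] the two inner
    integrals are exchanged by Tonelli. Nesting the product as ((x, y), z) lets [z] and then [y] be
    integrated out, which yields measurability in [x]. *)
Lemma triple_integral_le (k : R) (F G : (T1 * T2) * T3 -> \bar R) :
  (0 <= k)%R ->
  measurable_fun setT F -> (forall z, 0 <= F z) ->
  measurable_fun setT G -> (forall z, 0 <= G z) ->
  (forall x z, k%:E * \int[m2]_y F (x, y, z) <= \int[m2]_y G (x, y, z)) ->
  k%:E * \int[m1]_x \int[m2]_y \int[m3]_z F (x, y, z) <=
  \int[m1]_x \int[m2]_y \int[m3]_z G (x, y, z).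
Proof.
move=> k0 mF F0 mG G0 FG.
have slice (H : (T1 * T2) * T3 -> \bar R) x : measurable_fun setT H ->
    measurable_fun setT (fun yz : T2 * T3 => H (x, yz.1, yz.2)).
  move=> mH; apply: (measurableT_comp mH).
  by do 2 apply: measurable_fun_pair => //.
have mint (H : (T1 * T2) * T3 -> \bar R) : measurable_fun setT H ->
    (forall z, 0 <= H z) ->
    measurable_fun setT (fun x => \int[m2]_y \int[m3]_z H (x, y, z)).
  move=> mH H0.
  have mH' := measurable_fun_fubini_tonelli_F (m2 := m3) H mH H0.
  apply: (measurable_fun_fubini_tonelli_F (m2 := m2) _ mH') => xy.
  exact: integral_ge0.
have swap (H : (T1 * T2) * T3 -> \bar R) x : measurable_fun setT H ->
    (forall z, 0 <= H z) ->
    \int[m2]_y \int[m3]_z H (x, y, z) = \int[m3]_z \int[m2]_y H (x, y, z).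
  by move=> mH H0; exact: (@fubini_tonelli _ _ _ _ _ m2 m3 _ (slice H x mH)).
have mint2 (H : (T1 * T2) * T3 -> \bar R) x : measurable_fun setT H ->
    (forall z, 0 <= H z) ->
    measurable_fun setT (fun z => \int[m2]_y H (x, y, z)).
  by move=> mH H0; exact: (measurable_fun_fubini_tonelli_G (m1 := m2) _ (slice H x mH)).
have int0 (H : (T1 * T2) * T3 -> \bar R) x : (forall z, 0 <= H z) ->
    0 <= \int[m2]_y \int[m3]_z H (x, y, z).
  move=> H0; apply: integral_ge0 => y _.
  exact: integral_ge0.
rewrite -ge0_integralZl_EFin//; [|by move=> x _; exact: int0|exact: mint].
apply: ge0_le_integral => //.
- by move=> x _; rewrite mule_ge0// ?lee_fin// int0.
- by apply: measurable_funeM; exact: mint.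
- exact: mint.
move=> x _; rewrite !swap//.
rewrite -ge0_integralZl_EFin//; last 2 first.
- by move=> z _; exact: integral_ge0.
- exact: mint2.
apply: ge0_le_integral => //.
- by move=> z _; rewrite mule_ge0// ?lee_fin// integral_ge0.
- by apply: measurable_funeM; exact: mint2.
- exact: mint2.
Qed.

End iterated_integrals.

(** * Comparison of the two dissipation functionals *)

Section dissipation_integrand.
Context {R : realType} {m : nat}.
Local Notation V := 'rV[R]_m.+2.
Local Notation L := (@lebesgue_rV R m.+2).
Variables (theta : R) (u : V) (c : R) (f : V -> R).
Hypotheses (theta0 : 0 < theta) (c0 : 0 < c).
Hypotheses (mf : measurable_fun setT f) (f0 : forall v, 0 <= f v).
Local Notation M := (maxwellian theta u).

(** Uncurried, with [z] standing for ((v, vs), n), so that joint measurability can be stated for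
    Tonelli; [n] is not yet restricted to the sphere. *)
Definition dissipation_integrand (gamma : R) (z : (V * V) * V) : \bar R :=
  ((collision_kernel m.+2 c gamma (enorm (z.1.1 - z.1.2))
      (xi z.1.1 z.1.2 z.2) * M z.1.1 * M z.1.2)%:E *
   Psi (f z.1.1 / M z.1.1)
     (f (post_collision z.1.1 z.1.2 z.2) /
      M (post_collision z.1.1 z.1.2 z.2)))%E.

Let on_sphere : set ((V * V) * V) := snd @^-1` sphere R m.+2.

Let M0 v : 0 < M v. Proof. exact: maxwellian_gt0. Qed.

Let fM0 v : 0 <= f v / M v. Proof. by rewrite divr_ge0// ltW. Qed.

Lemma measurable_relative_density d (T : measurableType d) (h : T -> V) :
  measurable_fun setT h -> measurable_fun setT (fun x => f (h x) / M (h x)).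
Proof.
move=> mh; apply: measurable_funM; first exact: measurableT_comp mf mh.
under eq_fun do rewrite -powR_inv1 ?(ltW (M0 _))//.
apply: (measurableT_comp (measurable_powR (- 1))).
exact: measurable_maxwellian.
Qed.

Lemma measurable_dissipation_integrand gamma :
  measurable_fun setT (dissipation_integrand gamma).
Proof.
have m1 : measurable_fun setT (fun z : (V * V) * V => z.1.1).
  exact: measurableT_comp measurable_fst measurable_fst.
have m2 : measurable_fun setT (fun z : (V * V) * V => z.1.2).
  exact: measurableT_comp measurable_snd measurable_fst.
have m3 : measurable_fun setT (fun z : (V * V) * V => z.2).
  exact: measurable_snd.
have mq : measurable_fun setT (fun z : (V * V) * V => z.1.1 - z.1.2).
  by apply: measurable_rV_add => //; exact: measurable_rV_opp.
have mpost : measurable_fun setT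
    (fun z : (V * V) * V => post_collision z.1.1 z.1.2 z.2).
  apply: measurable_rV_add => //; apply: measurable_rV_opp.
  by apply: measurable_rV_scale => //; exact: measurable_dot.
apply: emeasurable_funM; last first.
  by apply: measurable_Psi; exact: measurable_relative_density.
apply: measurableT_comp => //; apply: measurable_funM; last first.
  exact: measurable_maxwellian.
apply: measurable_funM; last exact: measurable_maxwellian.
apply: measurable_funM; last first.
  by apply: measurable_funX; exact: measurable_cosine.
apply: measurable_funM => //.
apply: (measurableT_comp (measurable_powR gamma)).
exact: (measurableT_comp measurable_enorm).
Qed.

Lemma dissipation_integrand_ge0 gamma z : (0 <= dissipation_integrand gamma z)%E.
Proof.
apply: mule_ge0; last exact: Psi_ge0.
rewrite lee_fin; apply: mulr_ge0; last exact: ltW.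
apply: mulr_ge0; last exact: ltW.
apply: mulr_ge0; last by rewrite exprn_ge0// /xi divr_ge0// enorm_ge0.
by apply: mulr_ge0; [exact: ltW|exact: powR_ge0].
Qed.

Local Open Scope ereal_scope.

(** After the substitution [x = v - y] the post-collisional velocity is [v - dot x w *: w]. The
    [Psi] factor is thus a function [G] of [dot x w], and [collision_weight_integral_le] applies
    with [k = c * M v]. *)
Lemma dissipation_integrand_le (gamma : R) (v w : V) :
  (0 <= gamma)%R -> dot w w = 1%R ->
  ((6^-1 `^ (gamma / 2) / 3)%R * theta `^ (gamma / 2))%:E *
    \int[L]_y dissipation_integrand 0 (v, y, w) <=
  \int[L]_y dissipation_integrand gamma (v, y, w).
Proof.
move=> gamma0 w1.
pose G t := Psi (f v / M v) (f (v - t *: w) / M (v - t *: w))%R.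
have mline : measurable_fun setT (fun t : R => v - t *: w)%R.
  apply: measurable_rV_add => //; apply: measurable_rV_opp.
  by apply: measurable_rV_scale => //; exact: measurable_id.
have mG : measurable_fun setT G.
  by apply: measurable_Psi => //; exact: measurable_relative_density.
have mslice g : measurable_fun setT (fun y => dissipation_integrand g (v, y, w)).
  apply: (measurableT_comp (measurable_dissipation_integrand g)).
  by do 2 apply: measurable_fun_pair => //.
have sliceE g : \int[L]_y dissipation_integrand g (v, y, w) =
    \int[L]_x ((c * M v * enorm x `^ g *
      ((`|dot x w| / enorm x) ^+ m * M (v - x)))%:E * G (dot x w)).
  rewrite -(ge0_integral_subl v (mslice g)); last first.
    by move=> y; exact: dissipation_integrand_ge0.
  apply: eq_integral => x _; rewrite /dissipation_integrand /= /xi.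
  rewrite /post_collision !subKr /collision_kernel !subSS subn0.
  by congr (_%:E * _); ring.
have k0 : (0 <= c * M v)%R by rewrite mulr_ge0// ltW.
have G0 t : 0 <= G t by exact: Psi_ge0.
rewrite [X in _ * X <= _](sliceE 0%R) [leRHS](sliceE gamma).
apply: le_trans (collision_weight_integral_le u v w1 theta0 gamma0 k0 mG G0).
(* The two sides differ by the factor |x|^0, which is 1 also at [x = 0]. *)
rewrite le_eqVlt; apply/orP; left; apply/eqP; congr (_ * _).
by apply: eq_integral => x _; rewrite powRr0 mulr1.
Qed.

(** Extending the integrand by zero off the sphere makes all three integrals run over full spaces,
    the form that [triple_integral_le] requires. *)
Lemma entropy_dissipationE gamma :
  entropy_dissipation theta u (collision_kernel m.+2 c gamma) f =
  (2^-1)%:E * \int[L]_v \int[L]_y \int[sphere_measure R m.+2]_w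
    (dissipation_integrand gamma \_ on_sphere) (v, y, w).
Proof.
apply: (congr1 (fun I => (2^-1)%:E * I)).
apply: eq_integral => v _; apply: eq_integral => y _.
rewrite [LHS]integral_mkcond; apply: eq_integral => w _; rewrite !patchE.
by congr (if _ then _ else _); apply/idP/idP; rewrite !inE.
Qed.

Lemma entropy_dissipation_le (gamma : R) : (0 <= gamma)%R ->
  ((6^-1 `^ (gamma / 2) / 3)%R * theta `^ (gamma / 2))%:E *
    entropy_dissipation theta u (collision_kernel m.+2 c 0) f <=
  entropy_dissipation theta u (collision_kernel m.+2 c gamma) f.
Proof.
move=> gamma0; rewrite !entropy_dissipationE muleCA lee_pmul2l ?lte_fin//.
have mS : measurable on_sphere.
  by apply: preimage_measurable => //; exact: measurable_sphere.
have mI g : measurable_fun setT (dissipation_integrand g \_ on_sphere).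
  by apply: measurable_erestrict => //; exact: measurable_dissipation_integrand.
have I0 g z : 0 <= (dissipation_integrand g \_ on_sphere) z.
  by apply: erestrict_ge0 => ? _; exact: dissipation_integrand_ge0.
apply: triple_integral_le => //.
  by rewrite !mulr_ge0 ?powR_ge0 ?invr_ge0.
move=> v w; have [wS|wS] := boolP (w \in sphere R m.+2).
  have IE g : \int[L]_y (dissipation_integrand g \_ on_sphere) (v, y, w) =
      \int[L]_y dissipation_integrand g (v, y, w).
    apply: eq_integral => y _; rewrite patchE mem_set//.
    by move: wS; rewrite inE.
  rewrite [X in _ * X <= _](IE 0%R) [leRHS](IE gamma).
  apply: dissipation_integrand_le => //.
  by apply: enorm_eq1; move: wS; rewrite inE.
rewrite integral0_eq ?mule0 => [|y _]; first exact: integral_ge0.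
rewrite patchE memNset// => zS; move: wS; rewrite notin_setE.
exact.
Qed.

End dissipation_integrand.

Theorem proposition1p4 (R : realType) (d : nat) (gamma : R)
    (hd : (2 <= d)%N) (hgamma : 0 <= gamma) :
  exists C : R, 0 < C /\
    forall (c : R), normalization_constant d c ->
    forall (theta : R) (u0 : 'rV[R]_d), 0 < theta ->
    forall f : 'rV[R]_d -> R, probability_density f ->
    ((C * theta `^ (gamma / 2))%:E *
       entropy_dissipation theta u0 (collision_kernel d c 0) f
     <= entropy_dissipation theta u0 (collision_kernel d c gamma) f)%E.
Proof.
(* This is (theta/6)^(gamma/2) / 3 without its power of [theta]: the bound for |q|^gamma outside the
   cylinder, times the third of the mass found there. *)
exists (6^-1 `^ (gamma / 2) / 3); split.
  by rewrite divr_gt0// powR_gt0 ?invr_gt0.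
case: d hd => [|[|m]]// _ c [c0 _] theta u0 theta0 f [f0 /integrableP[mf _] _].
by apply: entropy_dissipation_le => //; apply/measurable_EFinP.
Qed.
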